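(* Let $k\ge 2$ be an integer, and let $G=(V,E)$ be a graph on $n$ vertices with average degree $cn$, where $0\le c\le 1$. Then there exist vertices $u_0,\dots,u_{k-1}\in V$ such that \[ \bigl|N(u_0)\cup\cdots\cup N(u_{k-1})\bigr|\ \ge\ \min\bigl\{(1-(1-c)^k)\,n,\ \sqrt{c}\,n\bigr\}. \]
   Context: Graphs are finite and simple. For a graph $G=(V,E)$ with $n=|V|$ vertices and a vertex $u\in V$, $N(u)=\{x\in V : ux\in E\}$ denotes the (open) neighborhood of $u$ and $d(u)=|N(u)|$ its degree. The average degree of $G$ is $\sum_{u\in V} d(u)/n$; so the hypothesis says $\sum_{u\in V} d(u)=cn^2$. *)

(* Defs.v *)
From mathcomp Require Import all_boot all_order all_algebra.
From mathcomp Require Import reals.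

Set Implicit Arguments.
Unset Strict Implicit.
Unset Printing Implicit Defensive.

Import Order.TTheory GRing.Theory Num.Theory.

Local Open Scope ring_scope.

Definition simple_graph (V : finType) (E : rel V) : Prop :=
  symmetric E /\ irreflexive E.

Definition neighborhood (V : finType) (E : rel V) (u : V) : {set V} :=
  [set x | E u x].

Definition degree (V : finType) (E : rel V) (u : V) : nat :=
  #|neighborhood E u|.

(* Meaningful only for a nonempty vertex set (division by zero gives 0). *)
Definition average_degree (R : realType) (V : finType) (E : rel V) : R :=
  (\sum_(u : V) (degree E u)%:R) / #|V|%:R.

(* Main.v *)
Require Import Defs.
From mathcomp Require Import all_boot all_order all_algebra.
From mathcomp Require Import reals.
From mathcomp Require Import ring lra.

(** Choose the vertices greedily, starting with one of maximum degree.  Write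
    [d * n] for the maximum degree and [s] for the square root of [c].  If
    [s <= d], the first vertex alone is enough, so let [c <= d < s].

    Let [A], with [a * n] elements, be the union of the neighborhoods chosen
    so far.  Counting the adjacent pairs [(u, x)] with [x] outside [A] by
    either entry, the sets [N(u) :\: A] have average size at least
    [(c - d * a) * n], because the vertices of [A] absorb at most
    [d * n * #|A|] of the total degree [c * n^2]
    ([exists_large_extension]).  Some next vertex therefore brings the density
    of the union to at least [a * (1 - d) + c], and the first density is [d].

    For [d = c] this recursion produces exactly [b_j = 1 - (1 - c)^j], and for
    [d = s] it is constantly [s].  For [d] in between, the density after [j]
    steps never falls below the chord that joins these two values, the first
    one truncated at [s]; that is, it is at least
    [((s - d) * min(b_j, s) + (d - c) * s) / (s - c)]: one step from a point of
    the chord lands above the next chord by a positive multiple of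
    [(s - d) * (d - c) * (s - b)], where [b = min(b_j, s)] ([chord_step]).  A
    point of the chord is a weighted mean of [min(b_j, s)] and [s], hence at
    least [min(b_j, s)]. *)

Set Implicit Arguments.
Unset Strict Implicit.
Unset Printing Implicit Defensive.

Import Order.TTheory GRing.Theory Num.Theory.

Local Open Scope ring_scope.

Lemma exists_ge_average (T : finType) (x0 : T) (f : T -> nat) :
  exists x, (\sum_y f y <= #|T| * f x)%N.
Proof.
have [x _ fmax] := @arg_maxnP T x0 predT f isT.
by exists x; rewrite -sum_nat_const; apply: leq_sum => y _; apply: fmax.
Qed.

(** Both sides count the pairs of adjacent vertices with second entry outside
    [A]; symmetry turns the number of first entries into a degree. *)
Lemma sum_card_neighborhoodD (V : finType) (E : rel V) (A : {set V}) :
  symmetric E ->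
  (\sum_u #|neighborhood E u :\: A| = \sum_(x in ~: A) degree E x)%N.
Proof.
move=> symE.
transitivity (\sum_u \sum_(x in ~: A | E u x) 1)%N.
  apply: eq_bigr => u _; rewrite sum1dep_card; apply: eq_card => x.
  by rewrite !inE.
rewrite (exchange_big_dep (fun x => x \in ~: A)) => [|u x _ /andP[]//] /=.
apply: eq_bigr => x xA; rewrite sum1_card; apply: eq_card => u.
by rewrite [LHS]/in_mem /= xA inE symE.
Qed.

Lemma exists_large_extension (V : finType) (E : rel V) (x0 : V) (D : nat)
    (A : {set V}) :
  symmetric E -> (forall x, degree E x <= D)%N ->
  exists u, (#|V| * #|A| + \sum_x degree E x
               <= #|V| * #|A :|: neighborhood E u| + D * #|A|)%N.
Proof.
move=> symE leD.
have [u hu] := exists_ge_average x0 (fun u => #|neighborhood E u :\: A|).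
exists u; rewrite sum_card_neighborhoodD // in hu.
have -> : #|A :|: neighborhood E u| = (#|A| + #|neighborhood E u :\: A|)%N.
  by rewrite cardsU cardsD [_ :&: A]setIC addnBA // subset_leq_card // subsetIr.
have hD : (\sum_(x in A) degree E x <= D * #|A|)%N.
  by rewrite mulnC -sum_nat_const; apply: leq_sum.
rewrite mulnDr -addnA leq_add2l (bigID (mem A)) /= addnC leq_add //.
by rewrite (eq_bigl (mem (~: A))) // => x; rewrite !inE.
Qed.

(** With [s = d] or [d = c] the recursion [a |-> a * (1 - d) + c] maps [s] to
    itself, respectively [b] to [b * (1 - c) + c].  In between, the image of
    the chord exceeds the chord of the images by
    [(s - d) * (d - c) * (s - b)], after clearing the denominator [s - c]. *)
Lemma chord_step (R : realDomainType) (c s d b a a' : R) :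
  s ^+ 2 = c -> c <= d -> d <= s -> s <= 1 -> b <= s ->
  (s - d) * b + (d - c) * s <= (s - c) * a ->
  a * (1 - d) + c <= a' ->
  (s - d) * (b * (1 - c) + c) + (d - c) * s <= (s - c) * a'.
Proof.
move=> sE cd ds s1 bs ha ha'.
have h1 : (s - c) * (a * (1 - d) + c) <= (s - c) * a'.
  by apply: ler_wpM2l => //; lra.
have h2 : ((s - d) * b + (d - c) * s) * (1 - d) <= (s - c) * a * (1 - d).
  by apply: ler_wpM2r => //; lra.
have gap : 0 <= (s - d) * (d - c) * (s - b).
  by rewrite !mulr_ge0 // subr_ge0.
rewrite -sE in h1 h2 gap *; nra.
Qed.

(** Needed because [chord_step] assumes [b <= s], whereas [1 - (1 - c) ^+ j]
    may overtake [s]: the truncated sequence grows no faster than the recursion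
    allows, since [b |-> b * (1 - c) + c] does not decrease [s <= 1]. *)
Lemma minr_step (R : realDomainType) (c s b : R) :
  0 <= c -> c <= 1 -> s <= 1 ->
  Num.min (b * (1 - c) + c) s <= Num.min b s * (1 - c) + c.
Proof.
move=> c0 c1 s1; rewrite ge_min.
have [bs|sb] := leP b s; first by rewrite lexx.
apply/orP; right; nra.
Qed.

(** The induction extends a given choice [u] by one vertex found by averaging;
    indexing the vertices by [nat] rather than by ['I_j.+1] makes this an update
    of [u] at one point.  At [j = 0] the density is [d], which lies exactly on
    the chord through the values [c] at [d = c] and [s] at [d = s]. *)
Lemma greedy_union_above_chord (R : realType) (V : finType) (E : rel V)
    (v : V) (c s : R) :
  let n : R := #|V|%:R in
  let d := (degree E v)%:R / n in
  symmetric E -> (forall x, degree E x <= degree E v)%N ->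
  \sum_x (degree E x)%:R = c * n ^+ 2 ->
  0 <= c -> s ^+ 2 = c -> c <= d -> d <= s -> s <= 1 ->
  forall j, exists u : nat -> V,
    (s - d) * Num.min (1 - (1 - c) ^+ j.+1) s + (d - c) * s
    <= (s - c) * (#|\bigcup_(i < j.+1) neighborhood E (u i)|%:R / n).
Proof.
move=> n d symE vmax sumE c0 sE cd ds s1.
have n0 : 0 < n by rewrite ltr0n; apply/card_gt0P; exists v.
elim=> [|j [u IH]].
  exists (fun=> v); rewrite big_ord1 expr1 subKr -/d.
  have : (s - d) * Num.min c s <= (s - d) * c.
    by apply: ler_wpM2l; [lra | rewrite ge_min lexx].
  by move=> h; lra.
set A := (\bigcup_(i < j.+1) _) in IH.
have [w hw] := exists_large_extension v A symE vmax.
exists (fun i => if i == j.+1 then w else u i).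
rewrite big_ord_recr /= eqxx.
rewrite (eq_bigr (fun i : 'I_j.+1 => neighborhood E (u i))); last first.
  by move=> i _; rewrite ltn_eqF.
rewrite -/A; set B := A :|: _ in hw *.
have hB : #|A|%:R / n * (1 - d) + c <= #|B|%:R / n.
  move: hw; rewrite -(ler_nat R) !natrD !natrM natr_sum sumE -/n => hw.
  (* Both densities are put over [n ^+ 2], the scale of the edge count. *)
  have -> : #|A|%:R / n * (1 - d) + c
            = (n * #|A|%:R + c * n ^+ 2 - (degree E v)%:R * #|A|%:R) / n ^+ 2.
    by rewrite /d; field; rewrite gt_eqF.
  have -> : #|B|%:R / n = (n * #|B|%:R) / n ^+ 2 by field; rewrite gt_eqF.
  by rewrite ler_pM2r ?invr_gt0 ?exprn_gt0 // lerBlDr.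
have bs : Num.min (1 - (1 - c) ^+ j.+1) s <= s by rewrite ge_min lexx orbT.
apply: le_trans (chord_step sE cd ds s1 bs IH hB).
rewrite lerD2r; apply: ler_wpM2l; first lra.
have -> : 1 - (1 - c) ^+ j.+2 = (1 - (1 - c) ^+ j.+1) * (1 - c) + c.
  by rewrite (exprS _ j.+1); ring.
by apply: minr_step => //; lra.
Qed.

Theorem theorem1 (R : realType) (k : nat) (hk : (2 <= k)%N)
    (V : finType) (E : rel V) (hG : simple_graph E)
    (n : nat) (hn : #|V| = n) (hn0 : (0 < n)%N)
    (c : R) (hc0 : 0 <= c) (hc1 : c <= 1)
    (havg : average_degree R E = c * n%:R) :
  exists u : 'I_k -> V,
    (#|\bigcup_(i < k) neighborhood E (u i)|)%:R >=
      Num.min ((1 - (1 - c) ^+ k) * n%:R) (Num.sqrt c * n%:R).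
Proof.
have [symE _] := hG; subst n.
have n0 : 0 < #|V|%:R :> R by rewrite ltr0n.
have /card_gt0P [x0 _] := hn0.
have [v _ vmax'] := @arg_maxnP V x0 predT (degree E) isT.
have vmax x : (degree E x <= degree E v)%N by apply: vmax'.
set s := Num.sqrt c.
have sE : s ^+ 2 = c by rewrite sqr_sqrtr.
have s0 : 0 <= s by rewrite sqrtr_ge0.
have s1 : s <= 1 by rewrite -sqrtr1 ler_wsqrtr.
have sumE : \sum_x (degree E x)%:R = c * #|V|%:R ^+ 2 :> R.
  by rewrite expr2 mulrA -havg /average_degree divfK ?gt_eqF.
rewrite -minr_pMl ?ler0n //.
case: k hk => // k _.
pose d : R := (degree E v)%:R / #|V|%:R.
have [sd|ds] := leP s d.
  exists (fun=> v); rewrite -ler_pdivlMr // ge_min; apply/orP; right.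
  apply: le_trans sd _; rewrite ler_pM2r ?invr_gt0 // ler_nat subset_leq_card //.
  exact: (bigcup_sup ord0).
have cd : c <= d.
  rewrite /d ler_pdivlMr // -(ler_pM2r n0) -mulrA -expr2 -sumE.
  rewrite -natrM -natr_sum ler_nat mulnC -sum_nat_const.
  by apply: leq_sum.
have [u hu] :=
  greedy_union_above_chord symE vmax sumE hc0 sE cd (ltW ds) s1 k.
exists (fun i => u i); rewrite -ler_pdivlMr //.
rewrite -/d in hu; set b := Num.min _ _ in hu *.
have sc : 0 < s - c by lra.
rewrite -(ler_pM2l sc); apply: le_trans hu.
have bs : b <= s by rewrite ge_min lexx orbT.
have : (d - c) * b <= (d - c) * s by apply: ler_wpM2l => //; lra.
by move=> h; lra.
Qed.
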